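(* Let $(m_n)_n$ be a sequence of positive integers with $m_n\le n$ and $$\lim_{n\to\infty}\frac{m_n\log\log n}{\log n}=\infty .$$ Let $(A_n)_n$ be a sequence of random matrices on a common probability space, where $A_n$ is an $m_n\times n$ matrix ($m_n$ rows, $n$ columns) whose entries are positive, independent, and identically distributed as a random variable $\xi$ (whose distribution does not depend on $n$). Assume that for some $\beta>0$ $$\lim_{t\to\infty}\frac{\log\mathbb{P}(\xi\ge t)}{\log t}=-\frac1\beta .$$ Then almost surely $$\lim_{n\to\infty}\frac{\log\operatorname{per}A_n}{m_n\log n}=\max(1,\beta).$$
   Context: For $m\le n$, the permanent of an $m\times n$ matrix $A=(a_{i,j})$ is $\operatorname{per}A=\sum_{\pi}\prod_{i=1}^m a_{i,\pi(i)}$, where the sum is over all one-to-one functions $\pi:\{1,\dots,m\}\to\{1,\dots,n\}$. No assumption is made on the joint distribution of the matrices $A_n$ for different $n$. *)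

(* Defs.v *)
From HB Require Import structures.
From mathcomp Require Import all_boot all_order all_algebra.
From mathcomp Require Import all_classical all_reals all_analysis.

Set Implicit Arguments.
Unset Strict Implicit.
Unset Printing Implicit Defensive.

Import Order.TTheory GRing.Theory Num.Theory.
Import numFieldNormedType.Exports.

Local Open Scope classical_set_scope.
Local Open Scope ring_scope.

(* The intended range is m <= n: the sum runs over the injections of 'I_m into
   'I_n, so it is empty for m > n. *)
Definition per (R : comNzRingType) (m n : nat) (A : 'M[R]_(m, n)) : R :=
  \sum_(f : {ffun 'I_m -> 'I_n} | injectiveb f) \prod_(i < m) A i (f i).

Definition mutually_independent (d : measure_display) (T : measurableType d)
    (R : realType) (P : probability T R) (I : finType)
    (X : I -> {RV P >-> R}) : Prop :=
  forall (J : {set I}) (B : I -> set R),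
    (forall i, measurable (B i)) ->
    P (\bigcap_(i in [set` J]) (X i @^-1` B i)) =
    (\prod_(i in J) P (X i @^-1` B i))%E.

(* Equality of the two laws as measures, that is, on Borel sets only; X and Y may
   live on different probability spaces. *)
Definition same_law (d d' : measure_display) (T : measurableType d)
    (T' : measurableType d') (R : realType) (P : probability T R)
    (P' : probability T' R) (X : {RV P >-> R}) (Y : {RV P' >-> R}) : Prop :=
  forall B : set R, measurable B -> distribution P X B = distribution P' Y B.

(* Main.v *)
(* Upper bound: let [M = max 1 beta].  For [p <= 1] slightly below [1 / M],
   [per ^ p] is at most the sum over all maps [f] of the products of the
   [A i (f i) ^ p]; after rounding the entries up to powers of [n ^ delta], this
   sum has expectation at most [n ^ ((1 + o(1)) m)], and Markov's inequality gives
   a summable error since [m] tends to infinity.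

   Lower bounds: call an entry good if it exceeds a small constant [c], and big if
   it exceeds [n ^ tau] with [tau < beta].  Almost surely, eventually all rows and
   columns have at most [delta n] bad entries, and then a matching by good entries
   of some rows can be extended to any further row by changing at most one of its
   values.  Building matchings greedily and completing them by such steps gives
   [n ^ ((1 - o(1)) m)] good matchings.  Moreover, if no greedy step is possible
   for big entries after matching [k < (1 - delta) m] rows, then there is no big
   entry in a block of [m - k] rows and [n - k] columns, an event which a union
   bound excludes; completing the resulting matching by good entries keeps most of
   its values big. *)

Require Import Defs.
From HB Require Import structures.
From mathcomp Require Import all_boot all_order all_algebra.
From mathcomp Require Import all_classical all_reals all_analysis.
From mathcomp Require Import measurable_realfun ring lra zify.

Set Implicit Arguments.
Unset Strict Implicit.
Unset Printing Implicit Defensive.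

Import Order.TTheory GRing.Theory Num.Theory.
Import numFieldNormedType.Exports.

(** * Extending and counting matchings in a bipartite graph with few missing edges *)

Section Matchings.
Import fintype boot.finset.
Variables (m n : nat) (good : 'I_m -> 'I_n -> bool) (c0 : 'I_n).

(* The value [c0] outside [D] makes the encoding of partial injections by total
   functions unique, so that they can be counted. *)
Definition matching_on (D : {set 'I_m}) : {set {ffun 'I_m -> 'I_n}} :=
  [set f : {ffun 'I_m -> 'I_n} |
    [&& [forall i, (i \notin D) ==> (f i == c0)],
        [forall i in D, good i (f i)] &
        [forall i in D, [forall j in D, (f i == f j) ==> (i == j)]]]].

Lemma matching_onP (D : {set 'I_m}) (f : {ffun 'I_m -> 'I_n}) :
  reflect [/\ forall i, i \notin D -> f i = c0,
              forall i, i \in D -> good i (f i) &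
              {in D &, injective f}]
          (f \in matching_on D).
Proof.
rewrite inE; apply: (iffP and3P) => [[/forallP f0 /forall_inP fg fi]|[f0 fg fi]].
  split => // [i iD|i j iD jD fij]; first by apply/eqP/(implyP (f0 i)).
  by move/forall_inP: fi => /(_ i iD)/forall_inP/(_ j jD); rewrite fij eqxx => /eqP.
split; [apply/forallP => i|exact/forall_inP|apply/forall_inP => i iD].
  by apply/implyP => iD; rewrite f0.
by apply/forall_inP => j jD; apply/implyP => /eqP/(fi _ _ iD jD)/eqP.
Qed.

Lemma card_matching_image (D : {set 'I_m}) (f : {ffun 'I_m -> 'I_n}) :
  f \in matching_on D -> #|f @: D| = #|D|.
Proof. by case/matching_onP=> _ _ fi; rewrite card_in_imset. Qed.

Lemma matching_on0 : [ffun=> c0] \in matching_on set0.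
Proof.
by apply/matching_onP; split => [i _|i|i j]; rewrite ?ffunE ?inE.
Qed.

Definition assign (r : 'I_m) (f : {ffun 'I_m -> 'I_n}) (c : 'I_n) :
  {ffun 'I_m -> 'I_n} := [ffun x => if x == r then c else f x].

Lemma matching_assign (D : {set 'I_m}) f r c :
  f \in matching_on D -> r \notin D -> good r c -> c \notin f @: D ->
  assign r f c \in matching_on (r |: D).
Proof.
move=> /matching_onP[f0 fg fi] rD grc cD.
have cf i : i \in D -> c != f i.
  by move=> iD; apply: contraNneq cD => ->; exact: imset_f.
apply/matching_onP; split => [i|i|i j].
- by rewrite !inE negb_or ffunE => /andP[/negbTE-> /f0].
- by rewrite !inE ffunE; case: eqP => [->//|_ /= /fg].
- rewrite !inE !ffunE; case: eqP => [->|_]; case: eqP => [->|_] //=.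
  + by move=> _ /cf/eqP.
  + by move=> /cf/eqP ci _ /esym.
  + exact: fi.
Qed.

(** Add one free row and column at a time. The hypothesis ranges over arbitrary maps [f], so that it
    can come directly from a union bound over pairs [(D, f)]. *)
Lemma matching_greedy (K k : nat) :
  (forall (D : {set 'I_m}) (f : {ffun 'I_m -> 'I_n}), #|D| < K ->
    exists i j, [/\ i \notin D, j \notin f @: D & good i j]) ->
  k <= K ->
  exists (D : {set 'I_m}) f, #|D| = k /\ f \in matching_on D.
Proof.
move=> H; elim: k => [_|k IH kK].
  by exists set0, [ffun=> c0]; rewrite cards0 matching_on0.
have [|D [f [Dk fD]]] := IH; first exact: ltnW.
have [|i [j [iD jf bij]]] := H D f; first by rewrite Dk.
exists (i |: D), (assign i f j); split; first by rewrite cardsU1 iD Dk.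
exact: matching_assign.
Qed.

(* Inverse of an extension step: [o] names the row of the old matching whose
   column was given to the new row [r]. *)
Definition undo (r : 'I_m) (g : {ffun 'I_m -> 'I_n}) (o : option 'I_m) :=
  [ffun x => if x == r then c0 else if Some x == o then g r else g x].

Variable e : nat.
Hypothesis m_le_n : m <= n.
Hypothesis e_small : 3 * e < n.
Hypothesis row_bad : forall i, #|[set j | ~~ good i j]| <= e.
Hypothesis col_bad : forall j, #|[set i | ~~ good i j]| <= e.

Lemma free_columns (D : {set 'I_m}) f r : f \in matching_on D ->
  n - e - #|D| <= #|[set c | good r c & c \notin f @: D]|.
Proof.
move=> fD.
have := cardsC [set c | good r c & c \notin f @: D]; rewrite card_ord.
have sub : ~: [set c | good r c & c \notin f @: D]
   \subset [set j | ~~ good r j] :|: f @: D.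
  by apply/subsetP => c; rewrite !inE negb_and negbK.
have := subset_leq_card sub; have := row_bad r.
have := (leq_card_setU [set j | ~~ good r j] (f @: D)).1.
rewrite (card_matching_image fD); lia.
Qed.

(* If no free column is good for [r], swap: [r] takes the column of some matched
   row [i], which moves to a free column. *)
Lemma matching_step (D : {set 'I_m}) f r : f \in matching_on D -> r \notin D ->
  exists g u, g \in matching_on (r |: D) /\ f = undo r g u.
Proof.
move=> fD rD; have /matching_onP[f0 fg fi] := fD.
case: (set_0Vmem [set c | good r c & c \notin f @: D]) => [F0|[c]].
  have jn : n - e <= #|D|.
    by have := free_columns r fD; rewrite F0 cards0; lia.
  have Dm : #|D| < m.
    by have := subset_leq_card (subsetT (r |: D)); rewrite cardsU1 rD cardsT card_ord.
  have [c cD] : exists c, c \notin f @: D.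
    apply/existsP; rewrite -negb_forall; apply/negP => /forallP fT.
    have : [set: 'I_n] \subset f @: D by apply/subsetP.
    move/subset_leq_card; rewrite cardsT card_ord card_matching_image//; lia.
  (* Among the at least [n - e] rows of [D], at most [e] are bad for the column [c] and, [f] being
     injective on [D], at most [e] hold a column bad for [r]. Since [3 * e < n], some row avoids
     both. *)
  have [i iD [gic grfi]] : exists2 i, i \in D & good i c /\ good r (f i).
    case: (set_0Vmem [set i in D | good i c && good r (f i)]); last first.
      by case=> i; rewrite !inE => /and3P[iD ? ?]; exists i.
    move=> E0.
    have sub : D \subset [set i | ~~ good i c] :|:
        [set i in D | f i \in [set j | ~~ good r j]].
      apply/subsetP => i iD; have := in_set0 i; rewrite -E0 !inE iD /=.
      by move=> /negbT; rewrite negb_and.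
    have h1 := leq_trans (subset_leq_card sub) (leq_card_setU _ _).
    have h2 := col_bad c; have h3 := row_bad r.
    have h4 : #|[set i in D | f i \in [set j | ~~ good r j]]|
              <= #|[set j | ~~ good r j]|.
      rewrite -(@card_in_imset _ _ f); last first.
        by move=> i j; rewrite !inE => /andP[iD _] /andP[jD _]; exact: fi.
      by apply/subset_leq_card/subsetP => j /imsetP[i + ->]; rewrite !inE => /andP[].
    have h5 := leq_trans h1 (leq_add h2 (leq_trans h4 h3)).
    move: (leq_trans jn h5) e_small; lia.
  have rni : (r == i) = false by apply: contraNF rD => /eqP->.
  exists (assign r (assign i f c) (f i)), (Some i); split.
    have cf k : k \in D -> c != f k.
      by move=> kD; apply: contraNneq cD => ->; exact: imset_f.
    apply/matching_onP; split => [k|k|k l].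
    - rewrite !inE negb_or !ffunE => /andP[/negbTE-> kD]; case: eqP => [ki|_].
        by rewrite ki iD in kD.
      exact: f0.
    - by rewrite !inE !ffunE; case: eqP => [->//|_ /=]; case: eqP => [->//|_ /fg].
    - rewrite !inE !ffunE; case: (eqVneq k r) => [->|kr]; case: (eqVneq l r) => [->|lr] //=.
      + move=> _ lD; case: eqP => [_ /esym/eqP|li /fi il].
          by rewrite (negbTE (cf i iD)).
        by case: li; rewrite il.
      + move=> kD _; case: eqP => [_ /eqP|ki /fi il].
          by rewrite (negbTE (cf i iD)).
        by case: ki; rewrite il.
      + move=> kD lD; case: eqP => [->|ki]; case: eqP => [->|li] //.
        * by move/eqP; rewrite (negbTE (cf l lD)).
        * by move/esym/eqP; rewrite (negbTE (cf k kD)).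
        * exact: fi.
  apply/ffunP => x; rewrite !ffunE eqxx; case: eqP => [->|_]; first exact: f0.
  by rewrite (inj_eq Some_inj); case: eqP => [->|].
rewrite inE => /andP[grc cD]; exists (assign r f c), None; split.
  exact: matching_assign.
by apply/ffunP => x; rewrite !ffunE; case: eqP => [->|//]; exact: f0.
Qed.

(** Iterate [matching_step]: adding a row changes at most one earlier value, the one named by [u],
    and [m - #|D|] rows are to be added. *)
Lemma matching_extend (D : {set 'I_m}) f : f \in matching_on D ->
  exists2 g, g \in matching_on setT & #|[set i in D | f i != g i]| <= m - #|D|.
Proof.
have [k] := ubnP (m - #|D|); elim: k D f => // k IH D f kD fD.
case: (set_0Vmem (~: D)) => [D0|[r]].
  have -> : D = setT by rewrite -[D]setCK D0 setC0.
  exists f; first by rewrite -[X in matching_on X]setC0 -D0 setCK.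
  by rewrite (_ : [set i in _ | _] = set0) ?cards0//; apply/setP => i; rewrite !inE eqxx.
rewrite inE => rD; have [g [u [gD fE]]] := matching_step fD rD.
have Dm : #|r |: D| <= m.
  by have := subset_leq_card (subsetT (r |: D)); rewrite cardsT card_ord.
have cD : #|r |: D| = #|D|.+1 by rewrite cardsU1 rD.
have [| |h hT hg] := IH (r |: D) g; [lia|by []|].
exists h => //.
have sub : [set i in D | f i != h i] \subset
    [set i in r |: D | g i != h i] :|: [set i | Some i == u].
  apply/subsetP => i; rewrite !inE => /andP[iD]; rewrite iD orbT /=.
  rewrite fE !ffunE; case: (eqVneq i r) => [ir|_]; first by rewrite -ir iD in rD.
  by case: (Some i == u); rewrite ?orbT ?orbF.
have ho : #|[set i | Some i == u]| <= 1.
  case: u {fE sub} => [k0|].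
    by rewrite (_ : [set _ | _] = [set k0]) ?cards1//; apply/setP => x; rewrite !inE.
  by rewrite (_ : [set _ | _] = set0) ?cards0//; apply/setP => x; rewrite !inE.
have := leq_trans (leq_trans (subset_leq_card sub) (leq_card_setU _ _)) (leq_add hg ho).
move: cD Dm; lia.
Qed.

(** [undo r] recovers every [f] from an extension and an element of [option 'I_m], which has [m + 1]
    values. *)
Lemma card_matching_step (D : {set 'I_m}) r : r \notin D ->
  #|matching_on D| <= #|matching_on (r |: D)| * m.+1.
Proof.
move=> rD.
pose M := setX (matching_on (r |: D)) [set: option 'I_m].
have -> : #|matching_on (r |: D)| * m.+1 = #|M|.
  by rewrite cardsX cardsT card_option card_ord.
have sub : matching_on D \subset [set undo r p.1 p.2 | p in M].
  apply/subsetP => f fD; have [g [u [gD ->]]] := matching_step fD rD.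
  by apply/imsetP; exists (g, u); rewrite // in_setX in_setT gD.
exact: leq_trans (subset_leq_card sub) (leq_imset_card _ _).
Qed.

(** Giving [r] a free good column is injective in the old matching and the column together, and
    [free_columns] bounds the number of choices from below. *)
Lemma card_matching_grow (D : {set 'I_m}) r : r \notin D ->
  #|matching_on D| * (n - e - #|D|) <= #|matching_on (r |: D)|.
Proof.
move=> rD.
pose av (f : {ffun 'I_m -> 'I_n}) := [set c | good r c & c \notin f @: D].
pose M := [set p : {ffun 'I_m -> 'I_n} * 'I_n |
  (p.1 \in matching_on D) && (p.2 \in av p.1)].
have ME f c : ((f, c) \in M) = (f \in matching_on D) && (c \in av f) by rewrite [LHS]in_set.
have hM : #|matching_on D| * (n - e - #|D|) <= #|M|.
  rewrite -[leqRHS]sum1_card (eq_bigl (fun p : _ * _ => (p.1 \in matching_on D) &&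
    (p.2 \in av p.1))); last by move=> [f c]; rewrite ME.
  rewrite -(pair_big_dep (mem (matching_on D)) (fun f c => c \in av f) (fun _ _ => 1)) /=.
  rewrite -sum_nat_const; apply: leq_sum => f fD.
  by rewrite sum1_card free_columns.
apply: leq_trans hM _; rewrite -(@card_in_imset _ _ (fun p => assign r p.1 p.2)).
  apply/subset_leq_card/subsetP => g /imsetP[[f c]]; rewrite ME => /andP[fD + ->].
  by rewrite in_set => /andP[? ?]; exact: matching_assign.
(* The column is read off at [r], where both old matchings take the default value [c0]. *)
move=> [f c] [f' c']; rewrite !ME => /andP[fD _] /andP[fD' _].
move=> /ffunP E; have := E r; rewrite !ffunE eqxx /= => ->; congr pair.
apply/ffunP => x; have := E x; rewrite !ffunE; case: (eqVneq x r) => // -> _.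
by case/matching_onP: fD => f0 _ _; case/matching_onP: fD' => f0' _ _; rewrite f0 ?f0'.
Qed.

(** While fewer than [k] rows are matched, [k + 2 * e <= n] leaves at least [e] choices for the next
    one. *)
Lemma card_matching_small k : k <= m -> k + 2 * e <= n ->
  exists2 D : {set 'I_m}, #|D| = k & e ^ k <= #|matching_on D|.
Proof.
elim: k => [_ _|k IH km kn].
  by exists set0; rewrite ?cards0// expn0 card_gt0; apply/set0Pn; exists [ffun=> c0]; exact: matching_on0.
have [| |D Dk hD] := IH; [lia|lia|].
have [r rD] : exists r, r \notin D.
  apply/existsP; rewrite -negb_forall; apply/negP => /forallP fT.
  have : [set: 'I_m] \subset D by apply/subsetP.
  by move/subset_leq_card; rewrite cardsT card_ord; lia.
exists (r |: D); first by rewrite cardsU1 rD Dk.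
apply: leq_trans (card_matching_grow rD); rewrite expnSr leq_mul//; lia.
Qed.

(** Each row still to be added costs a factor of at most [m + 1], by [card_matching_step]. *)
Lemma card_matching_full (D : {set 'I_m}) :
  #|matching_on D| <= #|matching_on setT| * m.+1 ^ (m - #|D|).
Proof.
have [k] := ubnP (m - #|D|); elim: k D => // k IH D kD.
case: (set_0Vmem (~: D)) => [D0|[r]].
  by rewrite -[D]setCK D0 setC0 leq_pmulr// expn_gt0.
rewrite inE => rD.
have Dm : #|r |: D| <= m.
  by have := subset_leq_card (subsetT (r |: D)); rewrite cardsT card_ord.
have cD : #|r |: D| = #|D|.+1 by rewrite cardsU1 rD.
apply: (leq_trans (card_matching_step rD)).
have -> : m - #|D| = (m - #|r |: D|).+1 by lia.
rewrite expnSr mulnA leq_mul2r IH ?orbT//; lia.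
Qed.

Lemma card_matching_ge k : k <= m -> k + 2 * e <= n ->
  e ^ k <= #|matching_on setT| * m.+1 ^ (m - k).
Proof.
move=> km kn; have [D <- hD] := card_matching_small km kn.
exact: leq_trans hD (card_matching_full D).
Qed.

End Matchings.

Local Open Scope classical_set_scope.
Local Open Scope ring_scope.

(** * Markov's inequality, Borel-Cantelli and small values of a positive variable *)

Section ProbabilityBounds.
Context (R : realType) (d : measure_display) (T : measurableType d).
Variable P : probability T R.

Lemma markov_indic_sum (I : finType) (c : I -> R) (E : I -> set T) (s : R) :
  (forall i, 0 <= c i) -> (forall i, measurable (E i)) -> 0 < s ->
  measurable [set w | s <= \sum_i c i * \1_(E i) w] /\
  (P [set w | (s <= \sum_i c i * \1_(E i) w)%R]
    <= (s^-1 * \sum_i c i * fine (P (E i)))%:E)%E.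
Proof.
move=> c0 mE s0; set U := [set w | _].
have mf : measurable_fun setT (fun w => \sum_i c i * \1_(E i) w).
  by apply: measurable_sum => i; apply: measurable_funM => //; exact: measurable_indic.
have mU : measurable U.
  have := mf measurableT `[s, +oo[%classic (measurable_itv _).
  rewrite setTI; congr measurable; apply/seteqP; split => w /=;
    by rewrite in_itv /= andbT.
split=> //.
rewrite EFinM lee_pdivlMl//.
have eq : (\int[P]_w (\sum_i ((c i)%:E * (\1_(E i) w)%:E)) =
    \sum_i \int[P]_w ((c i)%:E * (\1_(E i) w)%:E))%E.
  apply: ge0_integral_sum => //.
    move=> i; apply: measurable_funeM; apply/measurable_EFinP.
    exact: measurable_indic.
  by move=> i w _; rewrite -EFinM lee_fin mulr_ge0.
have -> : ((\sum_i c i * fine (P (E i)))%:E =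
   \int[P]_w \sum_i ((c i)%:E * (\1_(E i) w)%:E))%E.
  rewrite eq -sumEFin; apply: eq_bigr => i _.
  rewrite ge0_integralZl ?lee_fin//.
    by rewrite integral_indic// setIT EFinM fineK// fin_num_measure.
  by apply/measurable_EFinP; exact: measurable_indic.
have <- : (\int[P]_w (s%:E * (\1_U w)%:E) = s%:E * P U)%E.
  rewrite ge0_integralZl ?lee_fin ?ltW//.
    by rewrite integral_indic// setIT.
  by apply/measurable_EFinP; exact: measurable_indic.
apply: ge0_le_integral => //.
- by move=> w _; rewrite -EFinM lee_fin mulr_ge0// ltW.
- by apply: measurable_funeM; apply/measurable_EFinP; exact: measurable_indic.
- apply: emeasurable_sum => i.
  by apply: measurable_funeM; apply/measurable_EFinP; exact: measurable_indic.
move=> w _; rewrite -EFinM.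
under eq_bigr do rewrite -EFinM.
rewrite sumEFin lee_fin indicE; case: (boolP (w \in U)) => [|_].
  by rewrite inE mulr1.
by rewrite mulr0 sumr_ge0// => i _; rewrite mulr_ge0.
Qed.

(** Markov's inequality at threshold 1 for the number of events that occur among those selected by
    [S]. *)
Lemma union_bound (I : finType) (S : pred I) (E : I -> set T) (b : R) :
  (forall i, measurable (E i)) -> 0 <= b ->
  (forall i, S i -> (P (E i) <= b%:E)%E) ->
  exists U, [/\ measurable U, (P U <= (#|I|%:R * b)%:E)%E &
    forall w, ~ U w -> forall i, S i -> ~ E i w].
Proof.
move=> mE b0 PE.
have [|mU PU] := @markov_indic_sum I (fun i => (S i)%:R) E 1 _ mE ltr01.
  by move=> i; rewrite ler0n.
eexists; split; [exact: mU| |].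
- apply: le_trans PU _; rewrite lee_fin invr1 mul1r.
  rewrite -sum1_card natr_sum mulr_suml; apply: ler_sum => i _.
  case: (boolP (S i)) => [Si|_]; last by rewrite mul0r mul1r.
  by rewrite !mul1r -lee_fin fineK ?PE// fin_num_measure.
- move=> w /= /negP; rewrite -ltNge => + i Si Ew; apply/negP; rewrite -leNgt.
  rewrite (bigD1 i)//= Si mul1r indicE mem_set//= lerDl.
  by apply: sumr_ge0 => j _; rewrite mulr_ge0.
Qed.

Lemma sum_inv_squares (n : nat) : \sum_(0 <= k < n) (k%:R ^- 2 : R) <= 2.
Proof.
(* The induction telescopes [1 / (k + 2)^2 <= 1 / (k + 1) - 1 / (k + 2)]; the term of index 0
   vanishes because the inverse of 0 is 0. *)
suff H k : \sum_(0 <= i < k.+2) (i%:R ^- 2 : R) <= 2 - k.+1%:R^-1.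
  case: n => [|[|k]]; first by rewrite big_geq.
    by rewrite big_nat1 expr0n /= invr0.
  by apply: le_trans (H k) _; rewrite gerBl invr_ge0.
elim: k => [|k IH].
  by rewrite big_nat_recr//= big_nat1 expr0n /= expr1n invr0 invr1; lra.
rewrite big_nat_recr//=; apply: (le_trans (lerD IH (lexx _))).
have k0 : (0 : R) < k.+1%:R by rewrite ltr0n.
have -> : k.+2%:R = k.+1%:R + 1 :> R by rewrite -natr1.
move: (k.+1%:R : R) k0 => x x0; rewrite -subr_ge0.
have -> : 2 - (x + 1)^-1 - (2 - x^-1 + (x + 1) ^- 2) = (x * (x + 1) ^+ 2)^-1.
  by field; rewrite !gt_eqF//; lra.
by rewrite invr_ge0 mulr_ge0 ?exprn_ge0//; lra.
Qed.

(** Borel-Cantelli: the exceptional sets have summable probabilities, so almost surely only finitely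
    many of them occur. *)
Lemma ae_near_infty (Q : nat -> T -> Prop) :
  (\forall n \near \oo, exists U, [/\ measurable U, (P U <= (n%:R ^- 2)%:E)%E &
    forall w, ~ U w -> Q n w]) ->
  {ae P, forall w, \forall n \near \oo, Q n w}.
Proof.
move=> [N _ HN].
have /choice [F HF] : forall n, exists U, [/\ measurable U, (P U <= (n%:R ^- 2)%:E)%E &
    (N <= n)%N -> forall w, ~ U w -> Q n w].
  move=> n; have [/HN[U [mU PU QU]]|nN] := leqP N n; first by exists U.
  by exists set0; rewrite measure0 lee_fin invr_ge0 exprn_ge0.
have mF n : measurable (F n) by case: (HF n).
have F0 : P (lim_sup_set F) = 0.
  apply: lim_sup_set_cvg0 => //; apply: (@le_lt_trans _ _ 2%:E); last exact: ltry.
  apply: lime_le; first by apply: is_cvg_nneseries.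
  near=> n; apply: (@le_trans _ _ (\sum_(0 <= k < n) (k%:R ^- 2)%:E)%E).
    by apply: lee_sum => k _; case: (HF k).
  by rewrite sumEFin lee_fin sum_inv_squares.
exists (lim_sup_set F); split => //.
  by apply: bigcap_measurable => // k _; exact: bigcup_measurable.
move=> w /= nQ k _; apply: contrapT => nF; apply: nQ.
exists (maxn N k) => // n /=; rewrite geq_max => /andP[Nn kn].
case: (HF n) => _ _ /(_ Nn); apply => Fnw; apply: nF.
by exists n.
Unshelve. all: by end_near. Qed.

(** Continuity from above: the events [xi < 1 / (k + 1)] decrease to the null event [xi <= 0]. *)
Lemma small_values (xi : {RV P >-> R}) (eta : R) : 0 < eta ->
  P [set w | xi w <= 0] = 0%E ->
  exists c, 0 < c <= 1 /\ fine (P (xi @^-1` `]-oo, c[)) <= eta.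
Proof.
move=> eta0 P0; pose F k := xi @^-1` `]-oo, (k.+1%:R^-1 : R)[.
have mF k : measurable (F k) by rewrite -[F k]setTI; exact: measurable_funP.
have capF : \bigcap_k F k = [set w | xi w <= 0].
  apply/seteqP; split => w /=.
    move=> Fw; rewrite leNgt; apply/negP => x0.
    have [k _ hk] := near_infty_natSinv_lt (PosNum x0).
    have := Fw k I; rewrite /F /= in_itv /= ltNge => /negP; apply.
    exact: ltW (hk k (leqnn k)).
  by move=> x0 k _; rewrite /F /= in_itv /=; apply: le_lt_trans x0 _; rewrite invr_gt0.
have : P \o F @ \oo --> P (\bigcap_k F k).
  apply: nonincreasing_cvg_mu => //.
  - exact: le_lt_trans (probability_le1 P (mF 0%N)) (ltry _).
  - by rewrite capF -(capF); apply: bigcap_measurable.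
  - apply/nonincreasing_seqP => k; apply/subsetPset => w; rewrite /F /= !in_itv /=.
    by move=> h; apply: lt_trans h _; rewrite ltf_pV2 ?posrE ?ltr0n// ltr_nat.
rewrite capF P0 => /fine_cvgP[_] /cvgr_lt - /(_ _ eta0)[k _ hk].
exists (k.+1%:R^-1); split.
  by rewrite invr_gt0 ltr0n /= invf_le1 ?ltr0n// ler1n.
exact/ltW/(hk k)/leqnn.
Qed.

End ProbabilityBounds.

(** * Power bounds from the logarithmic tail limit *)

Section Tail.
Context (R : realType) (G : R -> R) (l : R).
Hypothesis G_ge0 : forall t, 0 <= G t.
Hypothesis G_lim : ln (G t) / ln t @[t --> +oo] --> l.

(** If [G t = 0], the quotient is uninformative, as [ln 0] is 0 here, but the bound is trivial. *)
Lemma tail_le (a : R) : l < a ->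
  \forall t \near +oo, G t <= expR (a * ln t).
Proof.
move=> la; have near1 := cvgr_lt _ G_lim _ la.
near=> t.
have lt0 : 0 < ln t by apply: ln_gt0; near: t; exact: nbhs_pinfty_gt.
have : ln (G t) / ln t < a by near: t; exact: near1.
rewrite ltr_pdivrMr// => h.
have := G_ge0 t; rewrite le_eqVlt => /predU1P[<-|G0]; first exact: expR_ge0.
by rewrite -[leLHS]lnK ?posrE// ler_expR ltW.
Unshelve. all: by end_near. Qed.

(** The quotient is eventually negative, whereas [G t = 0] would make it 0, as [ln 0] is 0 here; so
    [G t] is positive and the logarithm can be inverted. *)
Lemma tail_ge (b : R) : l < 0 -> b < l ->
  \forall t \near +oo, expR (b * ln t) <= G t.
Proof.
move=> l0 bl; have near1 := cvgr_gt _ G_lim _ bl; have near2 := cvgr_lt _ G_lim _ l0.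
near=> t.
have lt0 : 0 < ln t by apply: ln_gt0; near: t; exact: nbhs_pinfty_gt.
have : b < ln (G t) / ln t by near: t; exact: near1.
rewrite ltr_pdivlMr// => h.
have h2 : ln (G t) / ln t < 0 by near: t; exact: near2.
have := G_ge0 t; rewrite le_eqVlt => /predU1P[G0|G0].
  by move: h2; rewrite -G0 ln0// mul0r ltxx.
by rewrite -[leRHS]lnK ?posrE// ler_expR ltW.
Unshelve. all: by end_near. Qed.

End Tail.

(** * Consequences of independence: blocks of entries and expectations of products *)

Section IidMatrix.
Context (R : realType) (d : measure_display) (T : measurableType d).
Context (d' : measure_display) (T' : measurableType d').
Variables (P : probability T R) (P' : probability T' R) (xi : {RV P' >-> R}).
Variables (m n : nat) (X : 'I_m -> 'I_n -> {RV P >-> R}).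
Hypothesis X_indep :
  mutually_independent (fun ij : 'I_m * 'I_n => X ij.1 ij.2).
Hypothesis X_law : forall i j, same_law (X i j) xi.

Let p (B : set R) : R := fine (P' (xi @^-1` B)).

Lemma iid_block (J : {set 'I_m * 'I_n}) (B : 'I_m * 'I_n -> set R) :
  (forall ij, measurable (B ij)) ->
  measurable (\bigcap_(ij in [set` J]) (X ij.1 ij.2 @^-1` B ij)) /\
  P (\bigcap_(ij in [set` J]) (X ij.1 ij.2 @^-1` B ij)) = (\prod_(ij in J) p (B ij))%:E.
Proof.
move=> mB; split.
  apply: fin_bigcap_measurable; first exact: finite_finset.
  by move=> ij _; rewrite -[X in measurable X]setTI; exact: measurable_funP.
rewrite X_indep// -prodEFin; apply: eq_bigr => ij _.
rewrite -[LHS]/(distribution P (X ij.1 ij.2) (B ij)) (X_law ij.1 ij.2 (mB ij)).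
rewrite /p fineK// fin_num_measure// -[X in measurable X]setTI.
exact: measurable_funP.
Qed.

(** By independence, a block of at least [k] cells has all its entries in [B] with probability at
    most [q ^+ k]; then sum over the blocks. It serves for single cells, for parts of a row or
    column, and for rectangles. *)
Lemma block_avoid (I : finType) (J : I -> {set 'I_m * 'I_n}) (B : set R) (q : R)
    (k : nat) : measurable B -> p B <= q <= 1 ->
  exists U, [/\ measurable U, (P U <= (#|I|%:R * q ^+ k)%:E)%E &
    forall w, ~ U w -> forall i, (k <= #|J i|)%N ->
      exists2 ij, ij \in J i & ~ B (X ij.1 ij.2 w)].
Proof.
move=> mB /andP[pq q1].
have p0 : 0 <= p B by rewrite /p fine_ge0.
have q0 := le_trans p0 pq.
have [|||U [mU PU HU]] := @union_bound _ _ _ P I (fun i => (k <= #|J i|)%N)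
  (fun i => \bigcap_(ij in [set` J i]) (X ij.1 ij.2 @^-1` B)) (q ^+ k).
- by move=> i; case: (@iid_block (J i) (fun=> B)).
- exact: exprn_ge0.
- move=> i ki; have [//|_ ->] := @iid_block (J i) (fun=> B).
  rewrite lee_fin prodr_const (le_trans (lerXn2r _ _ _ pq))//.
  exact: ler_wiXn2l.
exists U; split => // w /HU{}HU i /HU nE.
apply: contrapT => nex; apply: nE => ij /= ijJ.
by apply: contrapT => nB; apply: nex; exists ij.
Qed.

(** Expand each product over the choices of one [k] per row. Independence gives the expectation of
    every term, resumming over the [n ^ m] maps [f] produces the [m]-th power, and Markov's
    inequality concludes. *)
Lemma sum_product_bound (K : finType) (B : K -> set R) (v : K -> R) (s : R) :
  (forall k, measurable (B k)) -> (forall k, 0 <= v k) -> 0 < s ->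
  exists U, [/\ measurable U,
    (P U <= (s^-1 * (n%:R * \sum_k v k * p (B k)) ^+ m)%:E)%E &
    forall w, ~ U w ->
      \sum_(f : {ffun 'I_m -> 'I_n}) \prod_i \sum_k v k * \1_(B k) (X i (f i) w) < s].
Proof.
move=> mB v0 s0.
pose J (f : {ffun 'I_m -> 'I_n}) := [set (i, f i) | i : 'I_m]%SET.
pose I := ({ffun 'I_m -> 'I_n} * {ffun 'I_m -> K})%type.
pose E (x : I) := \bigcap_(ij in [set` J x.1]) (X ij.1 ij.2 @^-1` B (x.2 ij.1)).
pose c (x : I) := \prod_i v (x.2 i).
have c0 x : 0 <= c x by exact: prodr_ge0.
have HE x : measurable (E x) /\ P (E x) = (\prod_i p (B (x.2 i)))%:E.
  have [//|mE ->] := @iid_block (J x.1) (fun ij => B (x.2 ij.1)).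
  (* The cells [(i, f i)] lie in different rows, hence are distinct even when [f] is not
     injective. *)
  split => //; congr EFin; rewrite big_imset//=.
  by move=> i j _ _ [].
have [|mU PU] := @markov_indic_sum _ _ _ P I c E s c0 _ s0; first by move=> x; case: (HE x).
eexists; split; [exact: mU| |].
  suff -> : (n%:R * \sum_k v k * p (B k)) ^+ m = \sum_x c x * fine (P (E x)) by [].
  apply/esym.
  under eq_bigr => x _ do rewrite (HE x).2 /c /= -big_split /=.
  rewrite -(pair_big xpredT xpredT
    (fun (f : {ffun 'I_m -> 'I_n}) (k : {ffun 'I_m -> K}) => \prod_i (v (k i) * p (B (k i))))) /=.
  rewrite sumr_const card_ffun !card_ord -[LHS]mulr_natl natrX exprMn; congr (_ * _).
  by rewrite -(bigA_distr_bigA (fun (i : 'I_m) k => v k * p (B k))) /= prodr_const card_ord.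
move=> w /= /negP; rewrite -ltNge; congr (_ < _).
rewrite -(pair_big xpredT xpredT
  (fun (f : {ffun 'I_m -> 'I_n}) (k : {ffun 'I_m -> K}) => c (f, k) * \1_(E (f, k)) w)) /=.
apply: eq_bigr => f _; rewrite bigA_distr_bigA /=; apply: eq_bigr => k _.
rewrite big_split /=; congr (_ * _).
rewrite indicE; case: (boolP (w \in E (f, k))).
  rewrite inE => Ew; rewrite big1// => i _; rewrite indicE mem_set//.
  by apply: (Ew (i, f i)); apply/imsetP; exists i.
move=> /negP; rewrite inE => nE.
have [i nB] : exists i, ~ B (k i) (X i (f i) w).
  apply/existsNP => H; apply: nE => ij /= /imsetP[i _ ->]; exact: H.
by rewrite (bigD1 i)//= indicE memNset// mul0r.
Qed.

End IidMatrix.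

(** * Powers of sums and rounding to levels *)

Section PowerSums.
Context (R : realType).

(* Dividing by the sum reduces the claim to [y <= y `^ p] for [0 <= y <= 1]. *)
Lemma powR_sum_le (I : finType) (S : pred I) (x : I -> R) (p : R) :
  (forall i, 0 <= x i) -> 0 < p <= 1 ->
  (\sum_(i | S i) x i) `^ p <= \sum_(i | S i) x i `^ p.
Proof.
move=> x0 /andP[p0 p1]; set s := \sum_(i | S i) x i.
have s0 : 0 <= s by exact: sumr_ge0.
have sum0 : 0 <= \sum_(i | S i) x i `^ p by apply: sumr_ge0 => i _; exact: powR_ge0.
move: s0; rewrite le_eqVlt => /predU1P[<-|s0]; first by rewrite powR0 ?gt_eqF.
have -> : s `^ p = \sum_(i | S i) s `^ p * (x i / s).
  by rewrite -mulr_sumr -mulr_suml divff ?mulr1// gt_eqF.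
apply: ler_sum => i Si; have := x0 i; rewrite le_eqVlt => /predU1P[<-|xi0].
  by rewrite mul0r mulr0 powR_ge0.
have -> : x i `^ p = s `^ p * (x i / s) `^ p.
  by rewrite -powRM ?divr_ge0 ?ltW// mulrC divfK// gt_eqF.
rewrite ler_wpM2l ?powR_ge0// ger1_powR// divr_gt0//= ler_pdivrMr// mul1r.
by rewrite /s (bigD1 i)//= lerDl sumr_ge0.
Qed.

Lemma powR_prod (I : finType) (x : I -> R) (p : R) :
  (forall i, 0 <= x i) -> (\prod_i x i) `^ p = \prod_i x i `^ p.
Proof.
move=> x0.
suff [] : 0 <= \prod_i x i /\ (\prod_i x i) `^ p = \prod_i x i `^ p by [].
elim/big_ind2 : _ => [|a b a' b' [a0 ab] [a0' ab']|i _].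
- by rewrite ler01 powR1.
- by rewrite mulr_ge0// powRM// ab ab'.
- by [].
Qed.

(** With [L = ln n], the ray starting at [n ^ (delta * k)]. The rays are nested rather than
    disjoint, so their probabilities are tails; level 0 is the whole line so that small values are
    covered. *)
Definition level (delta L : R) (k : nat) : set R :=
  if k is 0%N then setT else `[expR (delta * k%:R * L), +oo[.

(** The largest level below [K] containing [x] alone gives a sufficient term, since [x] stays below
    the start of the next level; the other terms are nonnegative. *)
Lemma level_bound (delta L p x : R) (K : nat) : 0 < p -> 0 < x -> (0 < K)%N ->
  x < expR (delta * K%:R * L) ->
  x `^ p <= \sum_(k < K) expR (delta * k.+1%:R * L * p) * \1_(level delta L k) x.
Proof.
move=> p0 x0.
suff H : (0 < K)%N -> x < expR (delta * K%:R * L) -> exists k : 'I_K,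
    level delta L k x /\ x < expR (delta * k.+1%:R * L).
  move=> K0 /(H K0)[k [lk xk]].
  rewrite (bigD1 k)//= indicE mem_set// mulr1 -[leLHS]addr0.
  apply: lerD; last by apply: sumr_ge0 => j _; rewrite mulr_ge0// expR_ge0.
  rewrite /powR gt_eqF// ler_expR mulrC ler_pM2r//.
  by rewrite -ler_expR lnK ?posrE// ltW.
elim: K => // K IH _ xK.
case: K IH xK => [|K] IH xK; first by exists ord0.
have [xlt|xge] := ltP x (expR (delta * K.+1%:R * L)).
  by have [k [lk xk]] := IH isT xlt; exists (widen_ord (leqnSn _) k).
by exists ord_max; split => //=; rewrite in_itv /= xge.
Qed.

End PowerSums.

(** * Deterministic bounds on the permanent *)

Section PermanentBounds.
Context (R : realType) (m n : nat) (A : 'M[R]_(m, n)).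
Hypothesis A_gt0 : forall i j, 0 < A i j.

Let prod_gt0 (f : {ffun 'I_m -> 'I_n}) : 0 < \prod_i A i (f i).
Proof. exact: prodr_gt0. Qed.

(** [powR_sum_le] moves the power inside the sum, passing from injections to all maps adds
    nonnegative terms, and [level_bound] rounds each entry up. *)
Lemma ln_per_le (p delta L a : R) (K : nat) : 0 < p <= 1 -> (0 < K)%N ->
  (0 < per A) -> (forall i j, A i j < expR (delta * K%:R * L)) ->
  \sum_(f : {ffun 'I_m -> 'I_n}) \prod_i
    \sum_(k < K) expR (delta * k.+1%:R * L * p) * \1_(level delta L k) (A i (f i))
    < expR a ->
  p * ln (per A) <= a.
Proof.
move=> /andP[p0 p1] K0 per0 AK lta.
rewrite -ler_expR -[leLHS]/(expR _) (_ : expR (p * ln (per A)) = per A `^ p); last first.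
  by rewrite /powR gt_eqF.
apply: le_trans (ltW lta).
apply: le_trans (powR_sum_le _ (fun f => ltW (prod_gt0 f)) _) _; first by rewrite p0.
apply: (@le_trans _ _ (\sum_(f : {ffun 'I_m -> 'I_n}) (\prod_i A i (f i)) `^ p)).
  rewrite big_mkcond /=; apply: ler_sum => f _; case: ifP => // _; exact: powR_ge0.
apply: ler_sum => f _; rewrite powR_prod; last by move=> i; exact: ltW.
apply: ler_prod => i _; rewrite powR_ge0 /=; exact: level_bound.
Qed.

Lemma per_ge_prod (g : {ffun 'I_m -> 'I_n}) : injective g ->
  \prod_i A i (g i) <= per A.
Proof.
move=> /injectiveP gi; rewrite /per (bigD1 g)//= lerDl sumr_ge0// => f _; exact: ltW.
Qed.

Lemma per_gt0 : (m <= n)%N -> 0 < per A.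
Proof.
move=> mn; pose g := [ffun i => widen_ord mn i].
apply: lt_le_trans (prod_gt0 g) (per_ge_prod _).
by move=> i j; rewrite !ffunE => /(congr1 val) /= /val_inj.
Qed.

Variables (c : R) (e : nat).
Hypothesis c_gt0 : 0 < c.
Let good i j := c <= A i j.
Hypothesis m_le_n : (m <= n)%N.
Hypothesis e_small : (3 * e < n)%N.
Hypothesis row_bad : forall i, (#|[set j | ~~ good i j]%SET| <= e)%N.
Hypothesis col_bad : forall j, (#|[set i | ~~ good i j]%SET| <= e)%N.

Let c0 : 'I_n := Ordinal (leq_ltn_trans (leq0n _) e_small).

Lemma matching_onT_inj (b : 'I_m -> 'I_n -> bool) g : g \in matching_on b c0 [set: 'I_m]%SET -> injective g.
Proof. by case/matching_onP => _ _ gi i j; apply: gi; rewrite finset.in_setT. Qed.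

(** Each full good matching is an injection contributing at least [c ^+ m], and [card_matching_ge]
    bounds their number. *)
Lemma ln_per_ge_count (k : nat) : (0 < e)%N -> (k <= m)%N -> (k + 2 * e <= n)%N ->
  m%:R * ln c + k%:R * ln e%:R - (m%:R - k%:R) * ln m.+1%:R <= ln (per A).
Proof.
move=> e0 km kn.
have := card_matching_ge c0 m_le_n e_small row_bad col_bad km kn.
set N := #|_| => hN.
have perN : N%:R * c ^+ m <= per A.
  rewrite mulr_natl -sumr_const.
  rewrite /per; apply: (@le_trans _ _ (\sum_(f in matching_on good c0 [set: 'I_m]%SET) \prod_i A i (f i))).
    apply: ler_sum => f /matching_onP[_ fg _].
    rewrite -[m in leLHS]card_ord -prodr_const; apply: ler_prod => i _.
    by rewrite (ltW c_gt0) /=; apply: fg; rewrite finset.in_setT.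
  rewrite big_mkcond [leRHS]big_mkcond /=; apply: ler_sum => f _.
  case: ifP => [/matching_onT_inj/injectiveP->//|_]; case: ifP => // _; exact: ltW.
have N0 : (0 < N)%N.
  rewrite lt0n; apply: contraTneq hN => ->.
  by rewrite mul0n -ltnNge expn_gt0 e0.
have lnN : m%:R * ln c + ln N%:R <= ln (per A).
  rewrite addrC mulr_natl -lnXn// -lnM ?posrE ?ltr0n// ?exprn_gt0//.
  by rewrite ler_ln ?posrE ?per_gt0// mulr_gt0 ?ltr0n ?exprn_gt0.
have : ln ((e ^ k)%:R : R) <= ln ((N * m.+1 ^ (m - k))%:R : R).
  by rewrite ler_ln ?posrE ?ltr0n ?ler_nat ?muln_gt0 ?expn_gt0 ?e0 ?N0.
rewrite natrM !natrX lnM ?posrE ?exprn_gt0 ?ltr0n// !lnXn ?ltr0n//.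
rewrite -[ln e%:R *+ k]mulr_natl -[ln m.+1%:R *+ _]mulr_natl natrB//; lra.
Qed.

(** A greedy matching by entries at least [t] covers [m - s] rows and is good, as [c <= 1 <= t].
    Completing it changes at most [s] of its values, so at least [m - 2 * s] entries stay at least
    [t], and all are at least [c]. *)
Lemma ln_per_ge_big (t : R) (s : nat) : c <= 1 -> 1 <= t -> (2 * s <= m)%N ->
  (forall (D : {set 'I_m}) (f : {ffun 'I_m -> 'I_n}), (#|D| < m - s)%N ->
    exists i j, [/\ i \notin D, j \notin (f @: D)%SET & t <= A i j]) ->
  m%:R * ln c + (m%:R - 2 * s%:R) * ln t <= ln (per A).
Proof.
move=> c1 t1 sm H.
have [D [f [Dk fD]]] := matching_greedy c0 H (leqnn _).
have fDg : f \in matching_on good c0 D.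
  case/matching_onP: fD => f0 ft fi; apply/matching_onP; split => // i /ft ti.
  exact: le_trans c1 (le_trans t1 ti).
have [g gT gD] := matching_extend m_le_n e_small row_bad col_bad fDg.
pose B := [set i | t <= A i (g i)]%SET.
have hB : (m - 2 * s <= #|B|)%N.
  have sub : (D \subset [set i in D | f i != g i] :|: B)%SET.
    apply/fintype.subsetP => i iD; rewrite !inE iD /=; case: eqVneq => //= <-.
    by case/matching_onP: fD => _ /(_ i iD).
  have h := leq_trans (subset_leq_card sub) (leq_card_setU _ _).
  have : (m - s <= m - (m - s) + #|B|)%N.
    by rewrite -{1}Dk; apply: leq_trans h _; rewrite leq_add2r -Dk.
  move: #|B| => b; lia.
have t0 : 0 < t := lt_le_trans ltr01 t1.
have lt0 : 0 <= ln t by exact: ln_ge0.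
have lc0 : ln c <= 0 by exact: ln_le0.
apply: (@le_trans _ _ (ln (\prod_i A i (g i)))); last first.
  rewrite ler_ln ?posrE ?prod_gt0 ?per_gt0//; apply: per_ge_prod.
  exact: matching_onT_inj gT.
have -> : \prod_i A i (g i) = expR (\sum_i ln (A i (g i))).
  by rewrite expR_sum; apply: eq_bigr => i _; rewrite lnK// posrE.
rewrite expRK.
apply: (@le_trans _ _ (\sum_(i < m) (ln c + (i \in B)%:R * ln t))).
  rewrite big_split /= sumr_const card_ord mulr_natl lerD2l -mulr_suml.
  have -> : \sum_i (i \in B)%:R = #|B|%:R :> R.
    rewrite -sum1_card natr_sum [RHS]big_mkcond; apply: eq_bigr => i _.
    by case: (i \in B).
  by rewrite ler_wpM2r// -natrM -natrB// ler_nat.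
apply: ler_sum => i _; case/matching_onP: gT => _ /(_ i (finset.in_setT i)) gi _.
have lg : ln c <= ln (A i (g i)) by rewrite ler_ln ?posrE.
case: (boolP (i \in B)) => [|_]; last by rewrite mul0r addr0.
rewrite inE mul1r => tA.
have : ln t <= ln (A i (g i)) by rewrite ler_ln ?posrE.
lra.
Qed.

End PermanentBounds.

(** * Estimates for large [n] *)

Section Asymptotics.
Context (R : realType).

Lemma near_ge_natr (C : R) : \forall n \near \oo, C <= n%:R.
Proof.
exists (Num.bound `|C|) => // n /= Cn; apply: le_trans (ler_norm C) _.
by apply: le_trans (ltW (archi_boundP (normr_ge0 C))) _; rewrite ler_nat.
Qed.

Lemma near_ge_ln (C : R) : \forall n \near \oo, C <= ln n%:R :> R.
Proof.
near=> n; have : expR C <= n%:R by near: n; exact: near_ge_natr.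
move=> h; rewrite -(expRK C) ler_ln ?posrE ?expR_gt0//.
exact: lt_le_trans (expR_gt0 _) h.
Unshelve. all: by end_near. Qed.

Lemma near_expR_ln (x : R) (Q : R -> Prop) : 0 < x ->
  (\forall t \near +oo, Q t) -> \forall n \near \oo, Q (expR (x * ln n%:R)).
Proof.
move=> x0 [t0 [_ Qt]]; near=> n; apply: Qt.
have h : t0 / x <= ln n%:R by near: n; exact: near_ge_ln.
have : t0 <= x * ln n%:R by rewrite mulrC -ler_pdivrMr.
by move=> h2; apply: le_lt_trans h2 _; apply: lt_le_trans (expR_ge1Dx _); rewrite ltrDr.
Unshelve. all: by end_near. Qed.

(** As [ln (ln n) <= ln n], the growth ratio is at most [m n]. *)
Lemma near_ge_rows (m : nat -> nat) (C : R) :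
  (fun n => (m n)%:R * ln (ln n%:R) / ln n%:R : R) @ \oo --> +oo ->
  \forall n \near \oo, C <= (m n)%:R.
Proof.
move=> /cvgryPge/(_ C) h; near=> n.
have L1 : 1 <= ln n%:R :> R by near: n; exact: near_ge_ln.
have : C <= (m n)%:R * ln (ln n%:R) / ln n%:R by near: n; exact: h.
move=> Cn; apply: le_trans Cn _; rewrite ler_pdivrMr; last exact: lt_le_trans L1.
by rewrite ler_wpM2l// ltW// ln_sublinear// (lt_le_trans _ L1).
Unshelve. all: by end_near. Qed.

Lemma natr_expR (n : nat) : (0 < n)%N -> n%:R = expR (ln n%:R) :> R.
Proof. by move=> n0; rewrite lnK// posrE ltr0n. Qed.

Lemma exprVn2_expR (n : nat) : (0 < n)%N -> n%:R ^- 2 = expR (- (2 * ln n%:R)) :> R.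
Proof. by move=> n0; rewrite expRN expRM_natl -natr_expR. Qed.

Lemma pow2_le_expR (n : nat) : 2 ^+ n <= expR n%:R :> R.
Proof.
rewrite -[n%:R]mulr1 expRM_natl lerXn2r ?nnegrE ?expR_ge0//.
by apply: le_trans (expR_ge1Dx 1).
Qed.

Lemma natr_le_expR (n : nat) : n%:R <= expR n%:R :> R.
Proof. by apply: le_trans (expR_ge1Dx _); rewrite lerDr. Qed.

(** The exponent exceeds [delta * n], so the power is at most [expR (- 4 n)]; this absorbs
    [a <= expR n], [2 ^ b <= expR n] and [n ^ 2 <= expR (2 n)]. *)
Lemma subset_count_bound (delta : R) (a b n : nat) : (0 < n)%N -> 0 < delta ->
  (a <= n)%N -> (b <= n)%N ->
  (a * 2 ^ b)%:R * expR (- (4 / delta)) ^+ (Num.trunc (delta * n%:R)).+1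
    <= n%:R ^- 2 :> R.
Proof.
move=> n0 d0 an bn; set e := Num.trunc _.
have he : delta * n%:R < e.+1%:R.
  by have /andP[] := truncn_itv (mulr_ge0 (ltW d0) (ler0n R n)).
rewrite exprVn2_expR// natrM natrX -expRM_natl.
have h1 : a%:R <= expR n%:R :> R by apply: le_trans (natr_le_expR n); rewrite ler_nat.
have h2 : 2 ^+ b <= expR n%:R :> R.
  by apply: le_trans (pow2_le_expR n); rewrite ler_weXn2l// ler1n.
apply: (@le_trans _ _ (expR n%:R * expR n%:R * expR (e.+1%:R * - (4 / delta)))).
  by rewrite ler_wpM2r ?expR_ge0// ler_pM// exprn_ge0.
rewrite -!expRD ler_expR.
have h3 : 4 * n%:R <= e.+1%:R * (4 / delta).
  by rewrite mulrA ler_pdivlMr// -mulrA mulrC [n%:R * _]mulrC; nra.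
have h4 : ln n%:R <= n%:R :> R by rewrite ltW// ln_sublinear// ltr0n.
lra.
Qed.

End Asymptotics.

(** * Almost sure bounds for the random permanents *)

Section RandomPermanent.
Context (R : realType) (d : measure_display) (T : measurableType d).
Context (P : probability T R).
Context (d' : measure_display) (T' : measurableType d') (P' : probability T' R).
Variables (m : nat -> nat) (A : forall n : nat, 'I_(m n) -> 'I_n -> {RV P >-> R}).
Variables (xi : {RV P' >-> R}) (beta : R).
Hypothesis m_bounds : forall n : nat, (0 < n)%N -> (0 < m n <= n)%N.
Hypothesis m_infty : forall C : R, \forall n \near \oo, C <= (m n)%:R.
Hypothesis A_indep : forall n : nat,
  mutually_independent (fun ij : 'I_(m n) * 'I_n => A ij.1 ij.2).
Hypothesis A_law : forall (n : nat) (i : 'I_(m n)) (j : 'I_n), same_law (A i j) xi.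
Hypothesis beta_gt0 : 0 < beta.
Let G (t : R) : R := fine (P' [set w | t <= xi w]).
Hypothesis xi_tail : ln (G t) / ln t @[t --> +oo] --> - beta^-1.

Let L (n : nat) : R := ln n%:R.
Let Aw (n : nat) (w : T) : 'M[R]_(m n, n) := \matrix_(i < m n, j < n) A i j w.

Let G_ge0 t : 0 <= G t. Proof. exact: fine_ge0. Qed.

Let measurable_xi (B : set R) : measurable B -> measurable (xi @^-1` B).
Proof. by move=> mB; rewrite -[X in measurable X]setTI; exact: measurable_funP. Qed.

Let tail_preimage t : xi @^-1` `[t, +oo[ = [set w | t <= xi w].
Proof. by apply/seteqP; split => w /=; rewrite in_itv /= andbT. Qed.

Lemma measurable_level (delta l : R) (k : nat) : measurable (level delta l k).
Proof. by case: k => [|k]; [exact: measurableT|exact: measurable_itv]. Qed.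

(* Markov's inequality for [per ^ p], [p = 1 / (max 1 beta + eps / 2)], with the
   entries rounded up to the levels [n ^ (k * eps / 4)]. *)
Lemma ln_per_upper (eps : R) : 0 < eps ->
  {ae P, forall w, \forall n \near \oo, (forall (i : 'I_(m n)) (j : 'I_n), 0 < A i j w :> R) ->
    ln (per (Aw n w)) <= (Num.max 1 beta + eps) * ((m n)%:R * L n)}.
Proof.
move=> eps0; set M := Num.max 1 beta.
have M1 : 1 <= M by rewrite le_max lexx.
have Mb : beta <= M by rewrite le_max lexx orbT.
(* [p <= 1] is what [powR_sum_le] asks for, and [p < 1 / beta] makes the tail of [xi] eventually at
   most [t ^ (- p)]. *)
pose p := (M + eps / 2)^-1.
have p0 : 0 < p by rewrite invr_gt0; lra.
have pM : p * (M + eps / 2) = 1 by rewrite mulVf// gt_eqF//; lra.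
have p1 : p <= 1 by rewrite invf_le1; lra.
have pb : - beta^-1 < - p.
  by rewrite ltrN2 ltf_pV2 ?posrE//; lra.
pose delta := eps / 4; have delta0 : 0 < delta by rewrite divr_gt0.
(* An entry reaches [n ^ (delta * K)] with probability at most [n ^ (- 4)], which leaves [n ^ (- 2)]
   after a union bound over at most [n ^ 2] entries. *)
pose K := (Num.bound (4 / (p * delta))).+1.
have K0 : (0 < K)%N by [].
have hK : 4 <= p * delta * K%:R.
  rewrite mulrC -ler_pdivrMr ?mulr_gt0//.
  apply: le_trans (ltW (archi_boundP _)) _; first by rewrite divr_ge0 ?mulr_ge0 ?ltW.
  by rewrite ler_nat.
have [t0 [_ ht0]] := tail_le G_ge0 xi_tail pb.
have level_tail n k : t0 < expR (delta * L n) -> 0 <= L n ->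
    fine (P' (xi @^-1` level delta (L n) k)) <= expR (- (p * delta * k%:R * L n)).
  move=> tn Ln0; case: k => [|k] /=.
    by rewrite mulr0 mul0r oppr0 expR0 preimage_setT probability_setT.
  rewrite tail_preimage; apply: le_trans (ht0 _ _) _; last by rewrite expRK ler_expR; lra.
  apply: lt_le_trans tn _; rewrite ler_expR -mulrA ler_pM2l//.
  by rewrite ler_peMl// ler1n.
have small n : t0 < expR (delta * L n) -> 0 <= L n -> (0 < n)%N -> (m n <= n)%N ->
    exists U, [/\ measurable U, (P U <= (n%:R ^- 2)%:E)%E & forall w, ~ U w ->
      forall (i : 'I_(m n)) (j : 'I_n), A i j w < expR (delta * K%:R * L n)].
  move=> tn Ln0 n0 mn.
  have q1 : expR (- (p * delta * K%:R * L n)) <= 1.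
    by rewrite -[leRHS]expR0 ler_expR oppr_le0 mulr_ge0// ?mulr_ge0 ?ltW.
  have [|U [mU PU HU]] := block_avoid (@A_indep n) (@A_law n)
    (q := expR (- (p * delta * K%:R * L n)))
    (fun ij => [set ij]%SET) 1 (measurable_level delta (L n) K).
    by rewrite level_tail.
  exists U; split => //.
    apply: le_trans PU _; rewrite lee_fin expr1 card_prod !card_ord.
    rewrite exprVn2_expR// natrM.
    apply: (@le_trans _ _ (n%:R * n%:R * expR (- (p * delta * K%:R * L n)))).
      by rewrite ler_wpM2r ?expR_ge0// ler_wpM2r// ler_nat.
    rewrite [X in X * X]natr_expR// -!expRD ler_expR -/(L n); nra.
  move=> w /HU{}HU i j; have [|ij] := HU (i, j); first by rewrite cards1.
  by rewrite inE => /eqP -> /=; rewrite in_itv /= andbT => /negP; rewrite -ltNge.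
(* The expectation is at most [n ^ (m n * (1 + 3 * p * eps / 8))]. The threshold [expR (a n)]
   exceeds it by [n ^ (m n * p * eps / 8)], which is at least [n ^ 2] once
   [m n >= 16 / (p * eps)]. *)
pose a n := (1 + p * eps / 2) * ((m n)%:R * L n).
pose v n (k : 'I_K) := expR (delta * k.+1%:R * L n * p).
have markov n : t0 < expR (delta * L n) -> 0 <= L n -> (0 < n)%N ->
    K%:R <= expR (p * eps / 8 * L n) -> 16 / (p * eps) <= (m n)%:R ->
    exists U, [/\ measurable U, (P U <= (n%:R ^- 2)%:E)%E & forall w, ~ U w ->
      \sum_(f : {ffun 'I_(m n) -> 'I_n}) \prod_i
        \sum_(k < K) v n k * \1_(level delta (L n) k) (A i (f i) w) < expR (a n)].
  move=> tn Ln0 n0 Kn mn.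
  have [||U [mU PU HU]] := sum_product_bound (@A_indep n) (@A_law n)
    (B := fun k : 'I_K => level delta (L n) k) (v := v n) _ _ (expR_gt0 (a n)).
  - by move=> k; exact: measurable_level.
  - by move=> k; exact: expR_ge0.
  exists U; split => //.
  apply: le_trans PU _; rewrite lee_fin exprVn2_expR// -expRN.
  apply: (@le_trans _ _ (expR (- a n) *
      (expR (L n) * (expR (p * eps / 8 * L n) * expR (delta * p * L n))) ^+ m n)).
    apply: ler_wpM2l; first exact: expR_ge0.
    apply: lerXn2r; rewrite ?nnegrE.
    - by rewrite mulr_ge0// sumr_ge0// => k _; rewrite mulr_ge0 ?expR_ge0// fine_ge0.
    - by rewrite !mulr_ge0// expR_ge0.
    rewrite [X in X * _]natr_expR//; apply: ler_wpM2l; first exact: expR_ge0.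
    apply: (@le_trans _ _ (K%:R * expR (delta * p * L n))); last first.
      by rewrite ler_wpM2r ?expR_ge0.
    rewrite mulr_natl -[K in leRHS]card_ord -sumr_const; apply: ler_sum => k _.
    (* Weight and tail cancel up to one level step, so every [k] contributes at most
       [expR (delta * p * L n)]. *)
    apply: (@le_trans _ _ (v n k * expR (- (p * delta * k%:R * L n)))).
      by rewrite ler_wpM2l ?expR_ge0// level_tail.
    by rewrite -expRD ler_expR -natr1; lra.
  rewrite -!expRD -expRM_natl -expRD ler_expR /a /delta -/(L n).
  have : 16 <= (m n)%:R * (p * eps) by rewrite -ler_pdivrMr// mulr_gt0.
  move: (m n)%:R => mm hm.
  suff : 16 * L n <= mm * (p * eps) * L n by lra.
  by rewrite ler_wpM2r.
have ae1 : {ae P, forall w, \forall n \near \oo,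
    forall (i : 'I_(m n)) (j : 'I_n), A i j w < expR (delta * K%:R * L n)}.
  apply: ae_near_infty; near=> n; apply: small.
  - near: n; apply: (near_expR_ln (Q := fun t => t0 < t)) => //; apply: nbhs_pinfty_gt; exact: num_real.
  - near: n; exact: near_ge_ln.
  - by near: n; exists 1%N.
  - by have /m_bounds/andP[] : (0 < n)%N by near: n; exists 1%N.
have ae2 : {ae P, forall w, \forall n \near \oo,
    \sum_(f : {ffun 'I_(m n) -> 'I_n}) \prod_i
      \sum_(k < K) v n k * \1_(level delta (L n) k) (A i (f i) w) < expR (a n)}.
  apply: ae_near_infty; near=> n; apply: markov.
  - near: n; apply: (near_expR_ln (Q := fun t => t0 < t)) => //; apply: nbhs_pinfty_gt; exact: num_real.
  - near: n; exact: near_ge_ln.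
  - by near: n; exists 1%N.
  - near: n; apply: (near_expR_ln (Q := fun t => K%:R <= t)); first by rewrite divr_gt0// mulr_gt0.
    by apply: nbhs_pinfty_ge; exact: num_real.
  - near: n; exact: m_infty.
move: ae1 ae2; apply: filterS2 => w h1 h2; near=> n => A0.
have n0 : (0 < n)%N by near: n; exists 1%N.
have mn : (m n <= n)%N by have /andP[] := m_bounds n0.
have Apos i j : 0 < Aw n w i j by rewrite mxE.
have h1n : forall (i : 'I_(m n)) (j : 'I_n), A i j w < expR (delta * K%:R * L n).
  by near: n.
have h2n : \sum_(f : {ffun 'I_(m n) -> 'I_n}) \prod_i
      \sum_(k < K) v n k * \1_(level delta (L n) k) (A i (f i) w) < expR (a n).
  by near: n.
have : p * ln (per (Aw n w)) <= a n.
  apply: (ln_per_le Apos _ K0 (per_gt0 Apos mn)) => //; first by rewrite p0.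
  - by move=> i j; rewrite mxE; exact: h1n.
  - under eq_bigr do under eq_bigr do under eq_bigr do rewrite mxE.
    exact: h2n.
(* Since [p^-1 = M + eps / 2], the product [p^-1 * (1 + p * eps / 2)] equals [M + eps]. *)
rewrite -ler_pdivlMl// invrK /a => h; apply: le_trans h _.
rewrite mulrA ler_wpM2r//; last by nra.
by rewrite mulr_ge0//; near: n; exact: near_ge_ln.
Unshelve. all: by end_near. Qed.

(** An entry falls below [c] with probability at most [expR (- (4 / delta))], small enough for a
    union bound over all sets of more than [delta * n] cells in one row or column. *)
Lemma good_entries (delta : R) : 0 < delta -> P' [set w | xi w <= 0] = 0%E ->
  exists c : R, 0 < c <= 1 /\ {ae P, forall w, \forall n \near \oo,
    (forall i : 'I_(m n),
      (#|[set j : 'I_n | ~~ (c <= A i j w)%R]%SET| <= Num.trunc (delta * n%:R))%N) /\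
    (forall j : 'I_n,
      (#|[set i : 'I_(m n) | ~~ (c <= A i j w)%R]%SET| <= Num.trunc (delta * n%:R))%N)}.
Proof.
move=> delta0 xi0; set e := fun n : nat => Num.trunc (delta * n%:R).
have [c [c01 pc]] := small_values (expR_gt0 (- (4 / delta))) xi0.
have q1 : expR (- (4 / delta)) <= 1.
  by rewrite -[leRHS]expR0 ler_expR oppr_le0 divr_ge0// ltW.
have pq : fine (P' (xi @^-1` `]-oo, c[)) <= expR (- (4 / delta)) <= 1 by rewrite pc.
exists c; split => //.
have mB : measurable `]-oo, c[%classic by exact: measurable_itv.
have ae1 : {ae P, forall w, \forall n \near \oo, forall i : 'I_(m n),
    (#|[set j : 'I_n | ~~ (c <= A i j w)%R]%SET| <= e n)%N}.
  apply: ae_near_infty; near=> n.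
  have n0 : (0 < n)%N by near: n; exists 1%N.
  have /andP[_ mn] := m_bounds n0.
  have [U [mU PU HU]] := block_avoid (@A_indep n) (@A_law n)
    (fun x : 'I_(m n) * {set 'I_n} => finset.setX [set x.1]%SET x.2) (e n).+1 mB pq.
  exists U; split => //.
    apply: le_trans PU _; rewrite lee_fin card_prod !card_ord.
    by rewrite -[#|{: {set 'I_n}}|]cardsT -powersetT card_powerset cardsT card_ord subset_count_bound.
  move=> w /HU{}HU i; rewrite leqNgt; apply/negP => iS.
  have [|[i' j]] := HU (i, [set j : 'I_n | ~~ (c <= A i j w)%R]%SET).
    by rewrite cardsX cards1 mul1n.
  rewrite finset.in_setX => /andP[/= /finset.set1P-> ]; rewrite inE -ltNge => Ac.
  by rewrite in_itv /= Ac.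
have ae2 : {ae P, forall w, \forall n \near \oo, forall j : 'I_n,
    (#|[set i : 'I_(m n) | ~~ (c <= A i j w)%R]%SET| <= e n)%N}.
  apply: ae_near_infty; near=> n.
  have n0 : (0 < n)%N by near: n; exists 1%N.
  have /andP[_ mn] := m_bounds n0.
  have [U [mU PU HU]] := block_avoid (@A_indep n) (@A_law n)
    (fun x : 'I_n * {set 'I_(m n)} => finset.setX x.2 [set x.1]%SET) (e n).+1 mB pq.
  exists U; split => //.
    apply: le_trans PU _; rewrite lee_fin card_prod !card_ord.
    by rewrite -[#|{: {set 'I_(m n)}}|]cardsT -powersetT card_powerset cardsT card_ord subset_count_bound.
  move=> w /HU{}HU j; rewrite leqNgt; apply/negP => jS.
  have [|[i j']] := HU (j, [set i : 'I_(m n) | ~~ (c <= A i j w)%R]%SET).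
    by rewrite cardsX cards1 muln1.
  rewrite finset.in_setX => /andP[/= + /finset.set1P ->]; rewrite inE -ltNge => Ac.
  by rewrite in_itv /= Ac.
move: ae1 ae2; apply: filterS2 => w h1 h2; near=> n.
by split; near: n; [exact: h1|exact: h2].
Unshelve. all: by end_near. Qed.

(** Apply [ln_per_ge_count] with [e] about [delta * n] and [k >= (1 - 4 * delta) * m n]: the first
    [k] rows give [k * L n] up to a constant per row, and completion costs at most
    [4 * delta * m n * (L n + 1)]. *)
Lemma ln_per_lower_one (eps : R) : 0 < eps -> P' [set w | xi w <= 0] = 0%E ->
  {ae P, forall w, \forall n \near \oo,
    (forall (i : 'I_(m n)) (j : 'I_n), 0 < A i j w :> R) ->
    (1 - eps) * ((m n)%:R * L n) <= ln (per (Aw n w))}.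
Proof.
(* The bound [1 / 8] yields [8 * e <= n]; the bound [eps / 16] keeps the loss [8 * delta * L n] per
   row below [eps / 2 * L n]. *)
move=> eps0 xi0; pose delta := Num.min (8^-1) (eps / 16).
have delta0 : 0 < delta by rewrite lt_min invr_gt0 ltr0n divr_gt0.
have delta8 : delta <= 8^-1 by rewrite ge_min lexx.
have delta16 : delta <= eps / 16 by rewrite ge_min lexx orbT.
have [c [/andP[c0 c1] aeG]] := good_entries delta0 xi0.
(* [C] collects the constant losses per row, absorbed as soon as [L n >= 1 + 2 * C / eps]. *)
pose C := 1 - ln c - ln (delta / 2).
apply: filterS aeG => w h; near=> n => A0.
have [row col] : (forall i : 'I_(m n),
      (#|[set j : 'I_n | ~~ (c <= A i j w)%R]%SET| <= Num.trunc (delta * n%:R))%N) /\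
    (forall j : 'I_n,
      (#|[set i : 'I_(m n) | ~~ (c <= A i j w)%R]%SET| <= Num.trunc (delta * n%:R))%N).
  by near: n.
have n0 : (0 < n)%N by near: n; exists 1%N.
have /andP[m0 mn] := m_bounds n0.
have n0R : 0 < n%:R :> R by rewrite ltr0n.
have nbig : 2 / delta <= n%:R by near: n; exact: near_ge_natr.
have Lbig : 1 + 2 * C / eps <= L n by near: n; exact: near_ge_ln.
have L1 : 1 <= L n by near: n; exact: near_ge_ln.
have Apos i j : 0 < Aw n w i j by rewrite mxE.
have dn2 : 2 <= delta * n%:R by rewrite mulrC -ler_pdivrMr.
have /andP[ele egt] := truncn_itv (mulr_ge0 (ltW delta0) (ler0n R n)).
set e := Num.trunc _ in row col ele egt.
have egt2 : delta / 2 * n%:R <= e%:R by rewrite -natr1 in egt; lra.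
have e0 : (0 < e)%N by rewrite -(ltr0n R); lra.
clearbody e.
have e3 : (8 * e <= n)%N by rewrite -(ler_nat R) natrM; nra.
pose k := minn (m n) (n - 2 * e).
have km : (k <= m n)%N by exact: geq_minl.
have e2n : (2 * e <= n)%N by apply: leq_trans e3; rewrite leq_mul2r orbT.
have kn : (k + 2 * e <= n)%N by rewrite addnC -leq_subRL ?geq_minr.
(* Either [k = m n], or [m n - k <= 2 * e <= 2 * delta * n] while [m n >= n - 2 * e >= n / 2]. *)
have mk : (m n)%:R - k%:R <= 4 * delta * (m n)%:R.
  have [mle|/ltnW mge] := leqP (m n) (n - 2 * e).
    by rewrite /k (minn_idPl mle) subrr !mulr_ge0// ltW.
  rewrite /k (minn_idPr mge).
  have := mge; rewrite -(ler_nat R); have := mn; rewrite -(ler_nat R).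
  by rewrite natrB// natrM; nra.
have e3n : (3 * e < n)%N by move: n0 e3; clear; lia.
apply: le_trans (ln_per_ge_count Apos c0 mn e3n _ _ e0 km kn); last first.
- by move=> j; rewrite (eq_card (B := [set i : 'I_(m n) | ~~ (c <= A i j w)%R]%SET))// => i; rewrite !inE mxE.
- by move=> i; rewrite (eq_card (B := [set j : 'I_n | ~~ (c <= A i j w)%R]%SET))// => j; rewrite !inE mxE.
have lne : L n + ln (delta / 2) <= ln e%:R.
  rewrite addrC -lnM ?posrE ?divr_gt0// ler_ln ?posrE ?ltr0n//.
  by rewrite mulr_gt0 ?divr_gt0.
have lnm : ln (m n).+1%:R <= L n + 1.
  rewrite -ler_expR expRD lnK ?posrE ?ltr0n// -natr_expR//.
  have e2 : 2 <= expR 1 :> R by apply: le_trans (expR_ge1Dx 1).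
  have : ((m n).+1%:R : R) <= n%:R * 2.
    by rewrite -natrM ler_nat; move: mn n0; clear; lia.
  nra.
have lc : ln c <= 0 by exact: ln_le0.
have ld : ln (delta / 2) <= 0 by apply: ln_le0; lra.
have kM : 0 <= k%:R :> R by [].
have kM2 : k%:R <= (m n)%:R :> R by rewrite ler_nat.
have m0R : 0 < (m n)%:R :> R by rewrite ltr0n.
have h1 : k%:R * (L n + ln (delta / 2)) <= k%:R * ln e%:R by rewrite ler_wpM2l.
have h2 : ((m n)%:R - k%:R) * ln (m n).+1%:R <= ((m n)%:R - k%:R) * (L n + 1).
  by rewrite ler_wpM2l// subr_ge0.
have h3 : (m n)%:R * ln (delta / 2) <= k%:R * ln (delta / 2) by rewrite ler_wnM2r.
have h4 : ((m n)%:R - k%:R) * (2 * L n + 1) <= 4 * delta * (m n)%:R * (2 * L n + 1).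
  by rewrite ler_wpM2r//; lra.
have h5 : delta * ((m n)%:R * (8 * L n + 4)) <= eps / 16 * ((m n)%:R * (8 * L n + 4)).
  by rewrite ler_wpM2r// mulr_ge0//; lra.
have h6 : (m n)%:R * C <= (m n)%:R * (eps / 2 * (L n - 1)).
  rewrite ler_wpM2l//; have : 2 * C / eps <= L n - 1 by lra.
  by rewrite ler_pdivrMr//; lra.
have h7 : 0 <= (m n)%:R * eps by rewrite mulr_ge0// ltW.
rewrite /C in h6.
lra.
Unshelve. all: by end_near. Qed.

(** A rectangle that blocks the greedy step has at least [delta ^ 2 * m n * n] cells, each big with
    probability at least [n ^ (- b * tau)]. It therefore occurs with probability at most
    [expR (- delta ^ 2 * m n * n ^ gamma)], with [gamma > 0], which beats the number [(2 * n) ^ m n]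
    of pairs [(D, f)]. *)
Lemma ln_per_lower_beta (tau eps : R) : 0 < tau < beta -> 0 < eps ->
  P' [set w | xi w <= 0] = 0%E ->
  {ae P, forall w, \forall n \near \oo,
    (forall (i : 'I_(m n)) (j : 'I_n), 0 < A i j w :> R) ->
    (tau - eps) * ((m n)%:R * L n) <= ln (per (Aw n w))}.
Proof.
(* [4 * delta * tau <= eps] limits the loss [2 * s n * tau * L n] to [eps / 2 * m n * L n]; the
   bound [1 / 4] gives [4 * s n <= m n]. *)
move=> /andP[tau0 taub] eps0 xi0; pose delta := Num.min (4^-1) (eps / (4 * tau)).
have delta0 : 0 < delta by rewrite lt_min invr_gt0 ltr0n divr_gt0// mulr_gt0.
have delta4 : delta <= 4^-1 by rewrite ge_min lexx.
have deltat : delta * (4 * tau) <= eps.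
  by rewrite -ler_pdivlMr ?mulr_gt0// ge_min lexx orbT.
have [c [/andP[c0 c1] aeG]] := @good_entries (8^-1) (ltac:(by rewrite invr_gt0)) xi0.
(* The midpoint is above [1 / beta], as the lower tail bound requires, and below [1 / tau], so that
   [gamma > 0]. *)
pose b := (tau^-1 + beta^-1) / 2.
have tb : beta^-1 < tau^-1 by rewrite ltf_pV2 ?posrE.
have btau : b * tau < 1.
  have : beta^-1 * tau < 1 by rewrite -ltr_pdivlMr// div1r.
  have : tau^-1 * tau = 1 by rewrite mulVf// gt_eqF.
  by rewrite /b; lra.
pose gamma := 1 - b * tau; have gamma0 : 0 < gamma by rewrite subr_gt0.
have l0 : - beta^-1 < 0 by rewrite oppr_lt0 invr_gt0.
have bl : - b < - beta^-1 by rewrite /b; lra.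
have tl := tail_ge G_ge0 xi_tail l0 bl.
pose s n := Num.trunc (delta * (m n)%:R).
pose t n := expR (tau * L n).
have s_itv n : (s n)%:R <= delta * (m n)%:R < (s n).+1%:R.
  exact: truncn_itv (mulr_ge0 (ltW delta0) (ler0n _ _)).
have sm n : (4 * s n <= m n)%N.
  rewrite -(ler_nat R) natrM; have /andP[] := s_itv n.
  by have : 0 <= (m n)%:R :> R by []; nra.
pose big n (w : T) := forall (D : {set 'I_(m n)}) (f : {ffun 'I_(m n) -> 'I_n}),
  (#|D| < m n - s n)%N ->
  exists i j, [/\ i \notin D, j \notin (f @: D)%SET & t n <= A i j w].
have bigP n : (0 < n)%N -> expR (- b * (tau * L n)) <= G (t n) ->
    1 + 3 * L n <= delta ^+ 2 * expR (gamma * L n) -> 0 <= L n ->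
    exists U, [/\ measurable U, (P U <= (n%:R ^- 2)%:E)%E & forall w, ~ U w -> big n w].
  move=> n0 Gt hL Ln0; have /andP[m0 mn] := m_bounds n0.
  have mB : measurable `]-oo, (t n)[%classic by exact: measurable_itv.
  have pB : fine (P' (xi @^-1` `]-oo, (t n)[)) = 1 - G (t n).
    have -> : xi @^-1` `]-oo, (t n)[ = ~` (xi @^-1` `[t n, +oo[).
      apply/seteqP; split => w /=; rewrite !in_itv /= andbT.
        by move=> h; apply/negP; rewrite -ltNge.
      by move/negP; rewrite -ltNge.
    have mt : measurable (xi @^-1` `[t n, +oo[) by apply: measurable_xi; exact: measurable_itv.
    by rewrite probability_setC// fineB ?fin_num_measure// tail_preimage.
  have pq : fine (P' (xi @^-1` `]-oo, (t n)[)) <= expR (- G (t n)) <= 1.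
    rewrite pB; apply/andP; split; first exact: expR_ge1Dx.
    by rewrite -[leRHS]expR0 ler_expR oppr_le0.
  (* Fewer than [m n - s n] matched rows leave at least [s n + 1] rows and [n - m n + s n + 1]
     columns, which exceed [delta * m n] and [delta * n] respectively. *)
  pose k := ((s n).+1 * (n - m n + (s n).+1))%N.
  have [U [mU PU HU]] := block_avoid (@A_indep n) (@A_law n)
    (fun x : {set 'I_(m n)} * {ffun 'I_(m n) -> 'I_n} =>
      finset.setX (~: x.1)%SET (~: (x.2 @: x.1))%SET) k mB pq.
  exists U; split => //.
    apply: le_trans PU _; rewrite lee_fin card_prod card_ffun !card_ord exprVn2_expR//.
    rewrite -[#|{: {set 'I_(m n)}}|]cardsT -powersetT card_powerset cardsT card_ord.
    have hk : (m n)%:R * (1 + 3 * L n) <= k%:R * G (t n).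
      apply: (@le_trans _ _ ((delta * (m n)%:R) * (delta * n%:R) * expR (- b * (tau * L n)))).
        apply: (@le_trans _ _ ((m n)%:R * (delta ^+ 2 * expR (gamma * L n)))).
          by rewrite ler_wpM2l.
        rewrite le_eqVlt; apply/predU1P; left.
        rewrite [n%:R]natr_expR// -/(L n).
        have -> : gamma * L n = L n + - b * (tau * L n) by rewrite /gamma; ring.
        by rewrite expRD; ring.
      have /andP[_ sl] := s_itv n.
      rewrite ler_pM// ?expR_ge0//; first by rewrite !mulr_ge0// ltW.
      rewrite natrM ler_pM ?mulr_ge0// ?(ltW sl)// ?(ltW delta0)//.
      rewrite natrD natrB//; have : ((m n)%:R : R) <= n%:R by rewrite ler_nat.
      nra.
    have mLn : (1 : R) <= (m n)%:R by rewrite ler1n.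
    rewrite natrM !natrX -[expR (- G _) ^+ _]expRM_natl.
    apply: (@le_trans _ _ (expR (m n)%:R * expR ((m n)%:R * L n) * expR (k%:R * - G (t n)))).
      rewrite ler_wpM2r ?expR_ge0// ler_pM ?exprn_ge0 ?pow2_le_expR//.
      by rewrite expRM_natl -natr_expR.
    rewrite -!expRD ler_expR -/(L n); nra.
  move=> w /HU{}HU D f Dm; have [|[i j]] := HU (D, f).
    have : (#|(f @: D)%SET| <= #|D|)%N by exact: leq_imset_card.
    rewrite cardsX /= [#|(~: D)%SET|]cardsCs [#|(~: (f @: D))%SET|]cardsCs !finset.setCK.
    rewrite !card_ord /k; move: #|(f @: D)%SET| #|D| (s n) Dm mn => x y z; clear.
    by move=> h1 h2 h3; apply: leq_mul; lia.
  rewrite finset.in_setX !finset.in_setC => /andP[/= iD jf].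
  by rewrite in_itv /= => /negP; rewrite -leNgt => tA; exists i, j.
have aeB : {ae P, forall w, \forall n \near \oo, big n w}.
  apply: ae_near_infty; near=> n.
  have Lbig : 8 / (delta ^+ 2 * gamma ^+ 2) <= L n by near: n; exact: near_ge_ln.
  have L1 : 1 <= L n by near: n; exact: near_ge_ln.
  have L0 : 0 <= L n by lra.
  apply: bigP => //.
  - by near: n; exists 1%N.
  - rewrite -[tau * L n]expRK; near: n.
    exact: (near_expR_ln (Q := fun t => expR (- b * ln t) <= G t)).
  (* From [expR x >= 1 + x ^ 2 / 2], the constant 8 in [Lbig] gives [delta ^ 2 * expR (gamma * L n)
     >= 4 * L n >= 1 + 3 * L n]. *)
  - have := expR_ge1Dxn 1 (mulr_ge0 (ltW gamma0) L0).
    have dg : 0 < delta ^+ 2 * gamma ^+ 2 by rewrite mulr_gt0// exprn_gt0.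
    rewrite ler_pdivrMr// in Lbig; move=> hexp.
    have d2 : 0 <= delta ^+ 2 by rewrite exprn_ge0// ltW.
    apply: le_trans (ler_wpM2l d2 hexp).
    rewrite (_ : (2`!)%:R = 2 :> R)//.
    have : 8 * L n <= (L n * (delta ^+ 2 * gamma ^+ 2)) * L n by rewrite ler_wpM2r.
    rewrite exprMn mulrDr; lra.
move: aeG aeB; apply: filterS2 => w h hB; near=> n => A0.
have [row col] : (forall i : 'I_(m n),
      (#|[set j : 'I_n | ~~ (c <= A i j w)%R]%SET| <= Num.trunc (8^-1 * n%:R : R))%N) /\
    (forall j : 'I_n,
      (#|[set i : 'I_(m n) | ~~ (c <= A i j w)%R]%SET| <= Num.trunc (8^-1 * n%:R : R))%N).
  by near: n.
have bigw : big n w by near: n.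
have n0 : (0 < n)%N by near: n; exists 1%N.
have /andP[m0 mn] := m_bounds n0.
have Lbig : - (2 * ln c) / eps <= L n by near: n; exact: near_ge_ln.
have L1 : 0 <= L n by near: n; exact: near_ge_ln.
have Apos i j : 0 < Aw n w i j by rewrite mxE.
have n0R : 0 < n%:R :> R by rewrite ltr0n.
have /andP[ele _] := truncn_itv (mulr_ge0 (ltac:(by rewrite invr_ge0) : 0 <= 8^-1 :> R) (ler0n R n)).
set e := Num.trunc _ in row col ele; clearbody e.
have e3n : (3 * e < n)%N by rewrite -(ltr_nat R) natrM; lra.
have t1 : 1 <= t n by rewrite -[leLHS]expR0 ler_expR mulr_ge0// ltW.
have sm2 : (2 * s n <= m n)%N by apply: leq_trans (sm n); rewrite leq_mul2r orbT.
apply: le_trans (ln_per_ge_big Apos c0 mn e3n _ _ c1 t1 sm2 _).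
- rewrite expRK; have /andP[sl _] := s_itv n.
  rewrite ler_pdivrMr// in Lbig.
  have m0R : 0 <= (m n)%:R :> R by [].
  have h1 : - (2 * ln c) * (m n)%:R <= L n * eps * (m n)%:R by rewrite ler_wpM2r.
  have tL : 0 <= tau * L n by rewrite mulr_ge0// ltW.
  have h2 : (s n)%:R * (tau * L n) <= delta * (m n)%:R * (tau * L n) by rewrite ler_wpM2r.
  have h3 : delta * (4 * tau) * ((m n)%:R * L n) <= eps * ((m n)%:R * L n).
    by rewrite ler_wpM2r// mulr_ge0.
  lra.
- by move=> i; rewrite (eq_card (B := [set j : 'I_n | ~~ (c <= A i j w)%R]%SET))// => j; rewrite !inE mxE.
- by move=> j; rewrite (eq_card (B := [set i : 'I_(m n) | ~~ (c <= A i j w)%R]%SET))// => i; rewrite !inE mxE.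
- by move=> D f Df; have [i [j [iD jf tA]]] := bigw D f Df; exists i, j; rewrite mxE.
Unshelve. all: by end_near. Qed.

End RandomPermanent.

(** * From countably many almost sure bounds to the limit *)

Lemma ae_all_positive (R : realType) (d : measure_display) (T : measurableType d)
    (P : probability T R) (m : nat -> nat)
    (A : forall n : nat, 'I_(m n) -> 'I_n -> {RV P >-> R}) :
  (forall (n : nat) (i : 'I_(m n)) (j : 'I_n), {ae P, forall w, 0 < A n i j w}) ->
  {ae P, forall w, forall (n : nat) (i : 'I_(m n)) (j : 'I_n), 0 < A n i j w}.
Proof.
move=> A_pos; apply: ae_foralln => n; apply: filter_forall => i.
by apply: filter_forall => j; exact: A_pos.
Qed.

Theorem theorem20 (R : realType)
  (d : measure_display) (T : measurableType d) (P : probability T R)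
  (d' : measure_display) (T' : measurableType d') (P' : probability T' R)
  (m : nat -> nat)
  (A : forall n : nat, 'I_(m n) -> 'I_n -> {RV P >-> R})
  (xi : {RV P' >-> R}) (beta : R)
  (m_bounds : forall n : nat, (0 < n)%N -> (0 < m n <= n)%N)
  (m_growth :
    (fun n : nat => (m n)%:R * ln (ln n%:R) / ln n%:R : R) @ \oo --> +oo)
  (A_pos : forall (n : nat) (i : 'I_(m n)) (j : 'I_n),
    {ae P, forall w, 0 < A n i j w})
  (A_indep : forall n : nat,
    mutually_independent (fun ij : 'I_(m n) * 'I_n => A n ij.1 ij.2))
  (A_law : forall (n : nat) (i : 'I_(m n)) (j : 'I_n), same_law (A n i j) xi)
  (beta_gt0 : 0 < beta)
  (xi_tail :
    ln (fine (P' [set w | t <= xi w])) / ln t @[t --> +oo] --> - beta^-1) :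
  {ae P, forall w,
    (fun n : nat => ln (per (\matrix_(i < m n, j < n) A n i j w))
                    / ((m n)%:R * ln n%:R)) @ \oo --> Num.max 1 beta}.
Proof.
have m_infty C : \forall n \near \oo, C <= (m n)%:R :> R by exact: near_ge_rows.
(* Positivity passes to [xi] through the law of an entry, which the matrix for [n = 1] provides. *)
have xi0 : P' [set w | xi w <= 0] = 0%E.
  have /andP[m1 _] := m_bounds 1%N isT.
  have setE (f : _ -> R) : f @^-1` `]-oo, 0] = [set w | f w <= 0].
    by apply/seteqP; split => w /=; rewrite in_itv.
  have := A_law 1%N (Ordinal m1) ord0 `]-oo, 0]%classic (measurable_itv _).
  rewrite /distribution /pushforward !setE => <-.
  apply: measure_negligible.
    rewrite -setE -[X in measurable X]setTI; exact: measurable_funP.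
  have := A_pos 1%N (Ordinal m1) ord0; apply: negligibleS => w /= Aw.
  by apply/negP; rewrite -leNgt.
(* A countable family of tolerances keeps the union of the exceptional sets null. *)
pose eps k : R := k.+1%:R^-1.
have eps0 k : 0 < eps k by rewrite invr_gt0.
have ae_upper := ae_foralln (fun k =>
  ln_per_upper m_bounds m_infty A_indep A_law beta_gt0 xi_tail (eps0 k)).
have ae_one := ae_foralln (fun k =>
  ln_per_lower_one m_bounds A_indep A_law (eps0 k) xi0).
(* The index [k.+1] keeps this value of [tau] positive, since [eps 0 = 1]. *)
have tau_itv k : 0 < beta - beta * eps k.+1 < beta.
  rewrite gtrBl mulr_gt0// andbT subr_gt0 gtr_pMr// invf_lt1 ?ltr0n//.
  by rewrite ltr1n.
have ae_beta := ae_foralln (fun k =>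
  ln_per_lower_beta m_bounds A_indep A_law beta_gt0 xi_tail (tau_itv k) (eps0 k) xi0).
have ae_pos := ae_all_positive A_pos.
apply: filterS2 (filterI ae_upper ae_one) (filterI ae_beta ae_pos).
move=> w [hu h1] [hb A0]; apply/cvgrPdist_le => e e0.
have b1 : 0 < 1 + beta by lra.
(* The largest loss is [beta * eps k.+1 + eps k], at most [(1 + beta) * eps k]. *)
have [k _ /(_ k (leqnn k)) /= ke] := near_infty_natSinv_lt (PosNum (divr_gt0 e0 b1)).
have {}ke : eps k * (1 + beta) <= e by rewrite -ler_pdivlMr// ltW.
apply: filter_app (near_ge_ln (1 : R)); move: (hu k) (h1 k) (hb k).
apply: filterS3 => n hun h1n hbn L1.
have n0 : (0 < n)%N by case: n L1 {hun h1n hbn} => //; rewrite ln0// ler10.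
have /andP[m0 _] := m_bounds n n0.
have mL0 : 0 < (m n)%:R * ln n%:R :> R by rewrite mulr_gt0 ?ltr0n//; lra.
set lp := ln (per _) in hun h1n hbn *.
have up : lp / ((m n)%:R * ln n%:R) <= Num.max 1 beta + eps k.
  by rewrite ler_pdivrMr//; apply: hun.
have lo1 : 1 - eps k <= lp / ((m n)%:R * ln n%:R).
  by rewrite ler_pdivlMr//; apply: h1n.
have lob : beta - beta * eps k.+1 - eps k <= lp / ((m n)%:R * ln n%:R).
  by rewrite ler_pdivlMr//; apply: hbn.
have ek : eps k.+1 <= eps k by rewrite lef_pV2 ?posrE ?ltr0n// ler_nat.
have := eps0 k => ek0.
have be : beta * eps k.+1 <= beta * eps k by rewrite ler_wpM2l// ltW.
have bek : 0 <= beta * eps k by rewrite mulr_ge0// ltW.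
move: up; rewrite ler_distl maxEle; case: ifP => _ up; apply/andP; split; lra.
Qed.
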